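(* Let $f\in\mathcal{A}_c(\mathbb{T})$ and $g\in\mathcal{BV}(\mathbb{T})$. Then $\int_{-\pi}^{\pi}f(t)g(nt)\,dt=o(n)$ as $n\to\infty$. The order estimate is sharp: for every $\psi:\mathbb{N}\to(0,\infty)$ with $\psi(n)=o(n)$ as $n\to\infty$ there are $f\in\mathcal{A}_c(\mathbb{T})$ and $g\in\mathcal{BV}(\mathbb{T})$ such that it is not the case that $\int_{-\pi}^{\pi}f(t)g(nt)\,dt=o(\psi(n))$ as $n\to\infty$.
   Context: ''Periodic'' means $2\pi$-periodic. $\mathcal{B}_c(\mathbb{T})$ is the set of continuous $F:\mathbb{R}\to\mathbb{R}$ with $F(-\pi)=0$ and $F(y+2n\pi)=F(y)+nF(\pi)$ for all $y\in[-\pi,\pi)$, $n\in\mathbb{Z}$. $\mathcal{A}_c(\mathbb{T})$ is the set of Schwartz distributions $f$ on $\mathbb{R}$ such that $f=F'$ (distributional derivative) for some $F\in\mathcal{B}_c(\mathbb{T})$; this $F$ is unique and is called the primitive of $f$. $\mathcal{BV}(\mathbb{T})$ is the set of periodic functions $g:\mathbb{R}\to\mathbb{R}$ of finite variation over $[-\pi,\pi]$. For $f\in\mathcal{A}_c(\mathbb{T})$ with primitive $F$ and $h\in\mathcal{BV}(\mathbb{T})$, the continuous primitive integral of the product is $\int_{-\pi}^{\pi}fh=F(\pi)h(\pi)-\int_{-\pi}^{\pi}F\,dh$ (Riemann--Stieltjes integral); here it is applied with $h(t)=g(nt)$, $n\in\mathbb{N}$. *)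

(* Defs.v *)
From HB Require Import structures.
From mathcomp Require Import all_boot all_order all_algebra.
From mathcomp Require Import all_classical all_reals all_analysis.

Set Implicit Arguments.
Unset Strict Implicit.
Unset Printing Implicit Defensive.

Import Order.TTheory GRing.Theory Num.Theory.
Import numFieldNormedType.Exports.

Local Open Scope ring_scope.
Local Open Scope classical_set_scope.

Section TestFunctions.
Variable R : realType.
Implicit Types phi psi : R -> R.

Definition smooth phi := forall n x, derivable (phi^`(n)) x 1.

Definition supported_in (K : set R) phi := forall x, ~ K x -> phi x = 0.

(* Functions in [C_c^oo(R)]; their distributions are the linear functionals that
   are sequentially continuous for [testfun_cvg]. *)
Definition test_pred : {pred R -> R} :=
  [pred phi | `[< smooth phi /\ exists2 K, compact K & supported_in K phi >]].

Lemma smooth_derive1nD phi psi (a : R) n : smooth phi -> smooth psi ->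
  derive1n n (a *: phi + psi) = a *: derive1n n phi + derive1n n psi.
Proof.
move=> sphi spsi; elim: n => [//|n IHn]; rewrite !derive1nS IHn.
apply/funext => x; rewrite derive1E deriveD; last 2 first.
- exact/derivableZ/sphi.
- exact: spsi.
by rewrite deriveZ; [rewrite -!derive1E | exact: sphi].
Qed.

Lemma test_pred_submod : submod_closed test_pred.
Proof.
split.
  rewrite unfold_in; apply/asboolP; split; last by exists set0 => //; exact: compact0.
  suff E n : (0 : R -> R)^`(n) = 0.
    by move=> n x; rewrite E; exact: derivable_cst.
  elim: n => [//|n IHn]; rewrite derive1nS IHn.
  by apply/funext => x; rewrite derive1_cst.
move=> a phi psi; rewrite !unfold_in.
move=> /asboolP[sphi [K cK Kphi]] /asboolP[spsi [L cL Lpsi]].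
apply/asboolP; split.
  move=> n x; rewrite smooth_derive1nD//.
  by apply: derivableD; [exact/derivableZ/sphi | exact: spsi].
exists (K `|` L); first exact: compactU.
move=> x /not_orP[Kx Lx].
have -> : (a *: phi + psi) x = a *: phi x + psi x by [].
by rewrite Kphi// Lpsi// addr0 scaler0.
Qed.

HB.instance Definition _ := GRing.isSubmodClosed.Build R (R -> R) test_pred
  test_pred_submod.

Record testfun := TestFun {
  testfun_fun :> R -> R;
  testfun_subproof : testfun_fun \in test_pred }.

HB.instance Definition _ := [isSub for testfun_fun].
HB.instance Definition _ := [Choice of testfun by <:].
HB.instance Definition _ := [SubChoice_isSubLmodule of testfun by <:].

Definition testfun_cvg (phi_ : nat -> testfun) (phi : testfun) :=
  (exists2 K, compact K & forall n, supported_in K (phi_ n)) /\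
  forall m : nat,
    {uniform, ((phi_ n : R -> R)^`(m) @[n --> \oo]) --> (phi : R -> R)^`(m)}.

Record schwartz_distribution := SchwartzDistribution {
  distribution_fun :> {linear testfun -> R};
  distribution_continuous : forall (phi_ : nat -> testfun) (phi : testfun),
    testfun_cvg phi_ phi ->
    distribution_fun (phi_ n) @[n --> \oo] --> distribution_fun phi }.

Definition is_distr_derivative (f : schwartz_distribution) (F : R -> R) :=
  forall phi : testfun,
    f phi = - \int[lebesgue_measure]_x (F x * derive1 phi x).

End TestFunctions.

Section RiemannStieltjes.
Variable R : realType.
Implicit Types (a b : R) (F h : R -> R) (s xi : seq R).

(* As in [itv_partition], [s] lists the points of the partition without [a]. *)
Definition tagged_partition a b s xi :=
  [/\ itv_partition a b s, size xi = size s &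
      forall i, (i < size s)%N ->
        (a :: s)`_i <= xi`_i <= (a :: s)`_i.+1].

Definition mesh_lt a s (delta : R) :=
  forall i, (i < size s)%N -> (a :: s)`_i.+1 - (a :: s)`_i < delta.

Definition stieltjes_sum F h a s xi : R :=
  \sum_(i < size s) F xi`_i * (h (a :: s)`_i.+1 - h (a :: s)`_i).

Definition is_stieltjes_integral a b F h (v : R) :=
  forall eps, 0 < eps -> exists2 delta, 0 < delta &
    forall s xi, tagged_partition a b s xi -> mesh_lt a s delta ->
      `|stieltjes_sum F h a s xi - v| < eps.

(* Limit as the mesh tends to 0; junk value 0 when it does not exist, which does
   not happen on [[a, b]] for [F] continuous and [h] of bounded variation. *)
Definition stieltjes_integral a b F h : R :=
  xget 0 [set v | is_stieltjes_integral a b F h v].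

End RiemannStieltjes.

Section ContinuousPrimitiveIntegral.
Variable R : realType.

Definition Bc : set (R -> R) :=
  [set F : R -> R | [/\ continuous F, F (- pi) = 0 &
    forall (y : R) (n : int), - pi <= y < pi ->
      F (y + 2 * n%:~R * pi) = F y + n%:~R * F pi]].

Definition Ac : set (schwartz_distribution R) :=
  [set f | exists2 F, Bc F & is_distr_derivative f F].

(* Each [f] in [Ac] has exactly one such [F]; junk value 0 outside of [Ac]. *)
Definition primitive (f : schwartz_distribution R) : R -> R :=
  xget (cst 0) [set F | Bc F /\ is_distr_derivative f F].

Definition BVT : set (R -> R) :=
  [set g : R -> R | periodic g (2 * pi) /\ bounded_variation (- pi) pi g].

(* The continuous primitive integral of [f h] over [[-pi, pi]]. *)
Definition cp_integral (f : schwartz_distribution R) (h : R -> R) : R :=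
  primitive f pi * h pi - stieltjes_integral (- pi) pi (primitive f) h.

End ContinuousPrimitiveIntegral.

(* Main.v *)
Require Import Defs.
From HB Require Import structures.
From mathcomp Require Import all_boot all_order all_algebra.
From mathcomp Require Import all_classical all_reals all_analysis.
From mathcomp Require Import ring lra zify.

Set Implicit Arguments.
Unset Strict Implicit.
Unset Printing Implicit Defensive.

Import Order.TTheory GRing.Theory Num.Theory.
Import numFieldNormedType.Exports.

Local Open Scope ring_scope.
Local Open Scope classical_set_scope.

(** Upper bound. Let [F] be the primitive of [f]. The integral is
    [F pi * g (n * pi)], which is bounded in [n], minus the Riemann--Stieltjes
    integral of [F] against [t |-> g (n * t)]. That integrator has [n] periods of
    length [2 * pi / n] in [[- pi, pi]], and over each of them its increments add up
    to 0 and its variation is that of [g]. Hence, up to an error of at most the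
    oscillation of [F] on intervals of length [2 * pi / n] times the variation of
    [g], each period contributes nothing
    ([periodic_increments_bound], [stieltjes_dilation_bound]). The [n] errors add up
    to [o(n)] because [F] is uniformly continuous.

    Sharpness. Take for [g] the square wave [(-1) ^ floor (t / pi)]. The integral of
    a continuous [F] against [t |-> g (n * t)] is, up to sign, twice the alternating
    sum of the values of [F] at the multiples of [pi / n] in [(- pi, pi]]
    ([is_stieltjes_integral_square_wave]). For [n = 2 ^ j] and [0 < l] this sum
    annihilates [cos (2 ^ l * t)] unless [l = j], when it equals [2 * n]
    ([alternating_sum_oscillation]). Choose [J] increasing with
    [psi (2 ^ J k) <= 2 ^ J k / 2 ^ k], which is possible since [psi] is [o(n)], and
    let [F] be the sum over [k] of [(cos (2 ^ J k * t) - 1) / 2 ^ k]. At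
    [n = 2 ^ J k] the integral has absolute value [4 * n / 2 ^ k >= 4 * psi n].

    The second part needs to know the primitive of the distribution [F'], that is,
    that a continuous function is determined up to a constant by its distributional
    derivative ([distr_derivative_le]). Test functions that detect a difference
    between two values are differences of two translates of a smooth step, built
    from [exp (- 1 / x)]. *)

(** * Smooth functions and a smooth step *)

Section Smooth.
Variable R : realType.
Implicit Types f g : R -> R.

(** Bounding the order makes the product and chain rules provable by induction:
    the derivative of [f * g] contains [f] itself, which is then used at a lower
    order. *)
Definition smooth_upto n f :=
  forall k, (k < n)%N -> forall x, derivable (f^`(k)) x 1.

Lemma smoothP f : smooth f <-> forall n, smooth_upto n f.
Proof.
by split=> [sf n k _|sf n]; [exact: sf | exact: sf n.+1 _ (ltnSn n)].
Qed.

Lemma smooth_uptoS n f :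
  smooth_upto n.+1 f <-> (forall x, derivable f x 1) /\ smooth_upto n f^`().
Proof.
split=> [sf|[df sf] [//|k kn]].
  split; first exact: sf 0%N isT.
  by move=> k kn; rewrite -derive1Sn; exact: sf.
by rewrite derive1Sn; exact: sf.
Qed.

Lemma smooth_uptoW n f : smooth_upto n.+1 f -> smooth_upto n f.
Proof. by move=> sf k kn; apply: sf; exact: ltnW. Qed.

Lemma smooth_derivable f x : smooth f -> derivable f x 1.
Proof. exact: (fun sf => sf 0%N x). Qed.

Lemma smooth_derive1 f : smooth f -> smooth f^`().
Proof. by move=> sf n; rewrite -derive1Sn; exact: sf. Qed.

Lemma derivable_continuous f : (forall x, derivable f x 1) -> continuous f.
Proof. by move=> df x; apply/differentiable_continuous/derivable1_diffP. Qed.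

Lemma smooth_continuous f : smooth f -> continuous f.
Proof. by move=> sf; apply: derivable_continuous => x; exact: sf 0%N x. Qed.

Lemma is_derive1E f (df : R -> R) :
  (forall x : R, is_derive x 1 f (df x)) -> f^`() = df.
Proof.
by move=> fdf; apply/funext => x; rewrite derive1E; exact: derive_val.
Qed.

Lemma derivable_is_derive1 f (x : R) :
  derivable f x 1 -> is_derive x 1 f (derive1 f x).
Proof. by move=> df; apply: DeriveDef => //; rewrite derive1E. Qed.

(** The derivative is a parameter so that inductions on [n] can run over families
    of functions that are closed under differentiation by an explicit formula. *)
Lemma smooth_upto_is_derive n f (df : R -> R) :
  (forall x : R, is_derive x 1 f (df x)) -> smooth_upto n df -> smooth_upto n.+1 f.
Proof.
move=> fdf sdf; apply/smooth_uptoS; split; first by move=> x; exact: ex_derive.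
by rewrite (is_derive1E fdf).
Qed.

Lemma is_derive1D f g (x a b : R) : is_derive x 1 f a -> is_derive x 1 g b ->
  is_derive x 1 (fun y => f y + g y) (a + b).
Proof. exact: is_deriveD. Qed.

Lemma is_derive1M f g (x a b : R) : is_derive x 1 f a -> is_derive x 1 g b ->
  is_derive x 1 (fun y => f y * g y) (f x * b + g x * a).
Proof. exact: is_deriveM. Qed.

Lemma smooth_upto_cst n (c : R) : smooth_upto n (fun=> c).
Proof.
elim: n c => [c k //|n IHn c].
apply: smooth_upto_is_derive (IHn 0) => x; exact: is_derive_cst.
Qed.

Lemma smooth_uptoD n f g :
  smooth_upto n f -> smooth_upto n g -> smooth_upto n (fun x => f x + g x).
Proof.
elim: n f g => [f g _ _ k //|n IHn] f g /smooth_uptoS[df sf] /smooth_uptoS[dg sg].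
apply: smooth_upto_is_derive (IHn _ _ sf sg) => x.
by apply: is_derive1D; exact: derivable_is_derive1.
Qed.

Lemma smooth_uptoM n f g :
  smooth_upto n f -> smooth_upto n g -> smooth_upto n (fun x => f x * g x).
Proof.
elim: n f g => [f g _ _ k //|n IHn] f g sf sg.
have [df sf'] := (smooth_uptoS n f).1 sf.
have [dg sg'] := (smooth_uptoS n g).1 sg.
apply: smooth_upto_is_derive (smooth_uptoD (IHn _ _ (smooth_uptoW sf) sg')
  (IHn _ _ (smooth_uptoW sg) sf')) => x.
by apply: is_derive1M; exact: derivable_is_derive1.
Qed.

Lemma is_derive1_compE f g (x : R) : derivable g x 1 -> derivable f (g x) 1 ->
  is_derive x 1 (f \o g) (derive1 f (g x) * derive1 g x).
Proof.
by move=> dg df; apply: is_derive1_comp; exact: derivable_is_derive1.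
Qed.

Lemma smooth_upto_comp n f g :
  smooth_upto n f -> smooth_upto n g -> smooth_upto n (f \o g).
Proof.
elim: n f g => [f g _ _ k //|n IHn] f g sf sg.
have [df sf'] := (smooth_uptoS n f).1 sf.
have [dg sg'] := (smooth_uptoS n g).1 sg.
apply: smooth_upto_is_derive (smooth_uptoM (IHn _ _ sf' (smooth_uptoW sg)) sg').
by move=> x; exact: is_derive1_compE.
Qed.

Lemma smooth_comp f g : smooth f -> smooth g -> smooth (f \o g).
Proof.
by move=> /smoothP sf /smoothP sg; apply/smoothP => n; exact: smooth_upto_comp.
Qed.

Lemma is_derive1_affine (a b x : R) : is_derive x 1 (fun y => a * y + b) a.
Proof.
have -> : (fun y => a * y + b) = (a \*: id + cst b) :> (R -> R) by [].
by apply: is_derive_eq; rewrite addr0 /GRing.scale/= mulr1.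
Qed.

Lemma smooth_affine (a b : R) : smooth (fun x => a * x + b).
Proof.
apply/smoothP => n; apply: smooth_uptoW.
apply: smooth_upto_is_derive (@smooth_upto_cst n a) => x.
exact: is_derive1_affine.
Qed.

(** The functions [x^-k exp(-1/x)] extended by 0 are considered for all [k] at
    once because their span is stable under differentiation. *)
Definition flat_exp k (x : R) : R :=
  if 0 < x then x ^- k * expR (- x^-1) else 0.

Lemma flat_exp_le0 k x : x <= 0 -> flat_exp k x = 0.
Proof. by rewrite /flat_exp leNgt => /negbTE ->. Qed.

Lemma flat_exp_ge0 k x : 0 <= flat_exp k x.
Proof.
rewrite /flat_exp; case: ifP => // x0.
by rewrite mulr_ge0 ?expR_ge0// invr_ge0 exprn_ge0// ltW.
Qed.

Lemma flat_exp_gt0 k x : 0 < x -> 0 < flat_exp k x.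
Proof.
by move=> x0; rewrite /flat_exp x0 mulr_gt0 ?expR_gt0// invr_gt0 exprn_gt0.
Qed.

(** Flatness at 0, from [y ^ m / m! <= exp y] with [y = 1/x] and [m = k + 2]. *)
Lemma flat_exp_le_sqr k x :
  `|flat_exp k x| <= (k.+2)`!%:R * x ^+ 2.
Proof.
rewrite ger0_norm ?flat_exp_ge0// /flat_exp; case: ifPn => [x0|_]; last first.
  by rewrite mulr_ge0// sqr_ge0.
have xV0 : 0 <= x^-1 by rewrite invr_ge0 ltW.
rewrite expRN ler_pdivrMr ?expR_gt0//.
apply: (@le_trans _ _ ((k.+2)`!%:R * x ^+ 2 * (x^-1 ^+ k.+2 / (k.+2)`!%:R))).
  rewrite -exprVn mulrC !mulrA -addn2 exprD.
  rewrite le_eqVlt; apply/orP; left; apply/eqP.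
  by field; rewrite !pnatr_eq0 -!lt0n fact_gt0 gt_eqF//= expf_neq0// gt_eqF.
rewrite ler_wpM2l ?mulr_ge0 ?(ltW x0)//.
by have := expR_ge1Dxn k.+1 xV0; lra.
Qed.

Lemma is_derive_flat_exp k (x : R) :
  is_derive x 1 (flat_exp k) (- k%:R * flat_exp k.+1 x + flat_exp k.+2 x).
Proof.
have [x0|x0|->] := ltgtP x 0.
- rewrite !flat_exp_le0 ?ltW// mulr0 addr0.
  apply: (@near_eq_is_derive _ _ _ (cst 0)).
  near=> y; rewrite flat_exp_le0//; apply/ltW; near: y; exact: lt_nbhsl.
- rewrite /flat_exp x0.
  apply: (@near_eq_is_derive _ _ _ (fun y : R => y^-1 ^+ k * expR (- y^-1))).
    near=> y; have -> : 0 < y by near: y; exact: lt_nbhsr.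
    by rewrite exprVn.
  have xn0 : x != 0 by rewrite gt_eqF.
  have dV : is_derive x 1 (fun y : R => y^-1) (- x ^- 2 *: 1) by apply: is_deriveV.
  have dX : is_derive x 1 (fun y : R => y^-1 ^+ k) (k%:R * x^-1 ^+ k.-1 * - x ^- 2).
    have := is_deriveX k dV; rewrite exprfctE => /is_derive_eq; apply.
    by rewrite /GRing.scale/= mulr1 mulr_natl.
  have dE : is_derive x 1 (fun y : R => expR (- y^-1)) (expR (- x^-1) * x ^- 2).
    have dN : is_derive x 1 (fun y : R => - y^-1) (x ^- 2).
      have := is_deriveN dV; rewrite opprfctE => /is_derive_eq; apply.
      by rewrite /GRing.scale/= mulr1 opprK.
    exact: (@is_derive1_comp _ expR _ _ _ _ (is_derive_expR _) dN).
  have := is_derive1M dX dE; move=> /@is_derive_eq; apply.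
  case: k {dX} => [|k] /=.
    by rewrite !expr0 !mul0r mulr0 oppr0 mul0r addr0 add0r mul1r mulrC.
  by rewrite !exprVn !exprS; field; rewrite xn0 expf_neq0.
- rewrite !flat_exp_le0// mulr0 addr0.
  (* The difference quotient is linearly small by the quadratic bound. *)
  have cvg0 : h^-1 *: ((flat_exp k \o shift (0 : R)) (h *: (1 : R)) - flat_exp k 0)
      @[h --> 0^'] --> (0 : R).
    apply: (@cvg_to_0_linear _ _ ((k.+2)`!%:R) 1) => // h /andP[h0 _].
    rewrite /= [flat_exp k 0]flat_exp_le0// subr0 addr0 /GRing.scale/= mulr1.
    rewrite normrM normfV ler_pdivrMl// (le_trans (flat_exp_le_sqr _ _))//.
    by rewrite -[h ^+ 2]real_normK ?num_real// expr2 mulrCA.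
  by apply: DeriveDef; [apply: cvgP cvg0 | apply: cvg_lim cvg0].
Unshelve. all: by end_near. Qed.

Lemma smooth_flat_exp k : smooth (flat_exp k).
Proof.
apply/smoothP => n; elim: n k => [k j //|n IHn k].
apply: smooth_upto_is_derive
  (smooth_uptoD (smooth_uptoM _ (IHn k.+1)) (IHn k.+2)).
  exact: is_derive_flat_exp.
exact: smooth_upto_cst.
Qed.

Lemma derive1_flat_exp0_ge0 x : 0 <= derive1 (flat_exp 0) x.
Proof.
rewrite (is_derive1E (is_derive_flat_exp 0)) oppr0 mul0r add0r.
exact: flat_exp_ge0.
Qed.

(** Smooth and nondecreasing, 0 on the left of 0 and a positive constant on the
    right of 1: the inner function [flat_exp 0 (1 - x)] falls from above
    [flat_exp 0 1] to 0. *)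
Definition smooth_step (x : R) : R :=
  flat_exp 0 (flat_exp 0 1 - flat_exp 0 (1 - x)).

Lemma flat_exp0_homo (x y : R) : x <= y -> flat_exp 0 x <= flat_exp 0 y.
Proof.
move=> xy; rewrite /flat_exp !expr0 !invr1 !mul1r; case: ifPn => x0; last first.
  by case: ifP => // _; exact: expR_ge0.
have y0 := lt_le_trans x0 xy; rewrite y0 ler_expR lerN2 lef_pV2//.
Qed.

Lemma smooth_step_le0 x : x <= 0 -> smooth_step x = 0.
Proof.
by move=> x0; rewrite /smooth_step flat_exp_le0// subr_le0 flat_exp0_homo//; lra.
Qed.

Lemma smooth_step_ge1 x : 1 <= x -> smooth_step x = smooth_step 1.
Proof.
move=> x1; rewrite /smooth_step; congr (flat_exp 0 (_ - _)).
by rewrite !flat_exp_le0//; lra.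
Qed.

Lemma smooth_step1_gt0 : 0 < smooth_step 1.
Proof.
rewrite /smooth_step subrr [flat_exp 0 0]flat_exp_le0// subr0.
by do 2 apply: flat_exp_gt0.
Qed.

Lemma smooth_stepE : smooth_step =
  flat_exp 0 \o ((fun x => -1 * x + flat_exp 0 1) \o
    (flat_exp 0 \o (fun x => -1 * x + 1))).
Proof.
apply/funext => x; rewrite /smooth_step /=.
by rewrite ![_ + flat_exp 0 1]addrC ![_ + 1]addrC !mulN1r.
Qed.

Lemma smooth_smooth_step : smooth smooth_step.
Proof.
rewrite smooth_stepE; apply: smooth_comp; first exact: smooth_flat_exp.
apply: smooth_comp; first exact: smooth_affine.
by apply: smooth_comp; [exact: smooth_flat_exp | exact: smooth_affine].
Qed.

Lemma derive1_smooth_step_ge0 x : 0 <= derive1 smooth_step x.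
Proof.
have d1 (a b y : R) : derive1 (fun x => a * x + b) y = a.
  by rewrite (is_derive1E (is_derive1_affine a b)).
have dE y : derivable (flat_exp 0) y 1 by apply: smooth_derivable; exact: smooth_flat_exp.
have dA (a b y : R) : derivable (fun x => a * x + b) y 1.
  by apply: smooth_derivable; exact: smooth_affine.
rewrite smooth_stepE.
have d2 y := is_derive1_compE (dA (-1) 1 y) (dE _).
have d3 y := is_derive1_compE (@ex_derive _ _ _ _ _ _ _ (d2 y)) (dA (-1) (flat_exp 0 1) _).
have d4 y := is_derive1_compE (@ex_derive _ _ _ _ _ _ _ (d3 y)) (dE _).
rewrite (is_derive1E d4) (is_derive1E d3) (is_derive1E d2) !d1.
rewrite mulN1r mulrN1 opprK mulr_ge0//; exact: derive1_flat_exp0_ge0.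
Qed.

End Smooth.

(** * Distributional derivatives of continuous functions *)

Section Distributions.
Variable R : realType.
Implicit Types (F G f g : R -> R) (phi : testfun R) (a b c r M : R).
Local Notation mu := (@lebesgue_measure R).

Lemma continuous_integrable_itv f a b :
  continuous f -> mu.-integrable `[a, b] (EFin \o f).
Proof.
move=> cf; apply: continuous_compact_integrable; first exact: segment_compact.
exact: continuous_subspaceT.
Qed.

Lemma continuous_mul f g : continuous f -> continuous g ->
  continuous (fun x => f x * g x).
Proof. by move=> cf cg x; apply: continuousM; [exact: cf | exact: cg]. Qed.

Lemma continuous_cstM c f : continuous f -> continuous (fun x => c * f x).
Proof. by apply: continuous_mul => x; exact: cvg_cst. Qed.

Lemma continuous_bounded_itv f a b : continuous f ->
  exists2 B, 0 < B & forall x, a <= x <= b -> `|f x| <= B.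
Proof.
move=> cf; have [ab|ba] := leP a b; last first.
  by exists 1 => // x /andP[ax xb]; have := le_trans ax xb; rewrite leNgt ba.
have cfn : {within `[a, b], continuous (fun x => `|f x|)}.
  apply: continuous_subspaceT => x; apply: continuous_comp; first exact: cf.
  exact: norm_continuous.
have [c _ fc] := EVT_max ab cfn.
exists (`|f c| + 1) => [|x xab]; first by rewrite ltr_wpDl.
by apply: le_trans (fc x _) _; [rewrite in_itv | rewrite lerDl].
Qed.

Definition null_outside M f := forall x, M < `|x| -> f x = 0.

Lemma null_outsideW M N f : M <= N -> null_outside M f -> null_outside N f.
Proof. by move=> MN f0 x Nx; apply: f0; exact: le_lt_trans Nx. Qed.

Lemma near_cst_derive1 f c x : (\forall y \near x, f y = c) -> derive1 f x = 0.
Proof.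
move=> fc; rewrite derive1E (@near_eq_derive _ _ _ _ (cst c))//.
exact: derive_cst.
Qed.

Lemma null_outside_derive1 M f : null_outside M f -> null_outside M (derive1 f).
Proof.
move=> f0 x Mx; apply: (@near_cst_derive1 _ 0).
near=> y; apply: f0; near: y.
have /cvgrPdist_lt/(_ (`|x| - M)) := @norm_continuous R R^o x.
rewrite subr_gt0 => /(_ Mx); apply: filterS => y.
by rewrite ltr_norml => /andP[_]; lra.
Unshelve. all: by end_near. Qed.

Lemma Rintegral_null_outside M f : null_outside M f ->
  \int[mu]_x f x = \int[mu]_(x in `[- M, M]) f x.
Proof.
move=> f0; rewrite [RHS]Rintegral_mkcond; congr (Rintegral mu _ _).
apply/funext => x; rewrite patchE; case: ifPn => // xM.
apply: f0; rewrite ltNge ler_norml; apply: contra xM => xM.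
by rewrite inE /= in_itv.
Qed.

Lemma Rintegral_derive1 a b f : a < b -> smooth f ->
  \int[mu]_(x in `[a, b]) derive1 f x = f b - f a.
Proof.
move=> ab sf; rewrite /Rintegral (@continuous_FTC2 _ _ f)//.
- apply: continuous_subspaceT; apply: smooth_continuous; exact: smooth_derive1.
- split=> [x _||]; first exact: smooth_derivable.
  + by apply: cvg_at_right_filter; exact: smooth_continuous.
  + by apply: cvg_at_left_filter; exact: smooth_continuous.
Qed.

Lemma testfun_smooth phi : smooth phi.
Proof. by have := testfun_subproof phi; rewrite unfold_in => /asboolP[]. Qed.

Lemma compact_null_outside (K : set R) : compact K ->
  exists2 M, 0 < M & forall f, supported_in K f -> null_outside M f.
Proof.
move=> /compact_bounded[M [_ KM]]; exists (Num.max 1 (M + 1)).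
  by rewrite lt_max ltr01.
move=> f Kf x; rewrite gt_max => /andP[_ Mx]; apply: Kf => Kx.
have : `|x| <= M + 1 by apply: KM => //; rewrite ltrDl.
by rewrite leNgt Mx.
Qed.

Lemma testfun_null_outside phi : exists2 M, 0 < M & null_outside M phi.
Proof.
have := testfun_subproof phi; rewrite unfold_in => /asboolP[_ [K cK Kphi]].
by have [M M0 KM] := compact_null_outside cK; exists M => //; exact: KM.
Qed.

Lemma testfun_continuous_derive1 phi : continuous (derive1 phi).
Proof.
by apply: smooth_continuous; apply: smooth_derive1; exact: testfun_smooth.
Qed.

Lemma Rintegral_testfun M F phi : null_outside M phi ->
  \int[mu]_x (F x * derive1 phi x) =
  \int[mu]_(x in `[- M, M]) (F x * derive1 phi x).
Proof.
move=> /null_outside_derive1 phi0.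
by apply: Rintegral_null_outside => x Mx; rewrite phi0// mulr0.
Qed.

Lemma derive1_testfunD (a : R) phi psi x :
  derive1 (a *: phi + psi : testfun R) x = a * derive1 phi x + derive1 psi x.
Proof.
have := smooth_derive1nD a 1 (@testfun_smooth phi) (@testfun_smooth psi).
by rewrite !derive1n1 => /(congr1 (fun f => f x)).
Qed.

Section DerivativeOfContinuous.
Variables (F : R -> R) (cF : continuous F).

(** [cF] is an argument for the linear and sequentially continuous structures to be
    inferred from the functional alone. *)
Definition derivative_functional of continuous F := fun phi =>
  - \int[mu]_x (F x * derive1 phi x).

Lemma derivative_functional_linear : linear (derivative_functional cF : _ -> R^o).
Proof.
move=> a phi psi; rewrite /derivative_functional.
have [M1 _ phi0] := testfun_null_outside phi.
have [M2 _ psi0] := testfun_null_outside psi.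
have phiM : null_outside (Num.max M1 M2) phi.
  by apply: null_outsideW phi0; rewrite le_max lexx.
have psiM : null_outside (Num.max M1 M2) psi.
  by apply: null_outsideW psi0; rewrite le_max lexx orbT.
set M := Num.max M1 M2 in phiM psiM.
have phipsiM : null_outside M (a *: phi + psi : testfun R).
  move=> x Mx; have -> : (a *: phi + psi : testfun R) x = a * phi x + psi x by [].
  by rewrite phiM// psiM// mulr0 addr0.
rewrite (Rintegral_testfun F phiM) (Rintegral_testfun F psiM).
rewrite (Rintegral_testfun F phipsiM).
have cphi := continuous_mul cF (@testfun_continuous_derive1 phi).
have cpsi := continuous_mul cF (@testfun_continuous_derive1 psi).
rewrite [X in _ = X + _]mulrN -opprD -RintegralZl//; last first.
  exact: continuous_integrable_itv.
rewrite -RintegralD//; last 2 first.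
- by apply: continuous_integrable_itv; exact: continuous_cstM.
- exact: continuous_integrable_itv.
congr (- _); apply: eq_Rintegral => x _.
by rewrite derive1_testfunD mulrDr mulrCA.
Qed.

HB.instance Definition _ := GRing.isLinear.Build R (testfun R) R^o *:%R
  (derivative_functional cF) derivative_functional_linear.

Lemma derivative_functional_cvg (phi_ : nat -> testfun R) phi :
  testfun_cvg phi_ phi ->
  derivative_functional cF (phi_ n) @[n --> \oo] --> derivative_functional cF phi.
Proof.
move=> [[K cK Kphi] /(_ 1%N) uphi].
have [M1 M10 KM] := compact_null_outside cK.
have [M2 _ phi0] := testfun_null_outside phi.
pose M := Num.max M1 M2.
have M0 : 0 < M by rewrite lt_max M10.
have phiM : null_outside M phi by apply: null_outsideW phi0; rewrite le_max lexx orbT.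
have phinM n : null_outside M (phi_ n).
  by apply: null_outsideW (KM _ (Kphi n)); rewrite le_max lexx.
have [B B0 FB] := @continuous_bounded_itv F (- M) M cF.
apply/cvgrPdist_le => e e0.
(* The error is an integral over [[- M, M]] of a function bounded by [B * d]. *)
pose d := e / (B * (M + M)).
have d0 : 0 < d by rewrite divr_gt0// mulr_gt0// addr_gt0.
have : \forall n \near \oo, forall x, `|derive1 phi x - derive1 (phi_ n) x| < d.
  apply: (uphi [set h : R -> R | forall x, `|derive1 phi x - h x| < d]).
  apply/uniform_nbhs; exists [set xy | `|xy.1 - xy.2| < d]; split.
    by exists d.
  by move=> h hd x; exact: hd.
apply: filterS => n phin.
rewrite /derivative_functional -opprB normrN opprK addrC.
rewrite (Rintegral_testfun F (phinM n)) (Rintegral_testfun F phiM).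
have cphi := continuous_mul cF (@testfun_continuous_derive1 phi).
have cpsi := continuous_mul cF (@testfun_continuous_derive1 (phi_ n)).
rewrite -RintegralB//; [|exact: continuous_integrable_itv..].
have cdiff : continuous (fun x => F x * derive1 phi x - F x * derive1 (phi_ n) x).
  by move=> x; apply: cvgB; [exact: cphi | exact: cpsi].
rewrite (le_trans (le_normr_Rintegral _ _))//; first exact: continuous_integrable_itv.
apply: (@le_trans _ _ (\int[mu]_(x in `[- M, M]) (B * d))).
  apply: le_Rintegral => //.
  - apply: continuous_integrable_itv => x.
    by apply: cvg_norm; exact: cdiff.
  - by apply: continuous_integrable_itv => x; exact: cvg_cst.
  - move=> x /=; rewrite in_itv/= => xM.
    by rewrite -mulrBr normrM ler_pM// ?FB// ltW.
rewrite Rintegral_cst//.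
have -> : fine (mu `[- M, M]) = M + M.
  have -> := lebesgue_measure_itv `[- M, M]%R.
  by rewrite /= lte_fin ifT/= ?opprK//; lra.
rewrite /d.
by rewrite le_eqVlt; apply/orP; left; apply/eqP; field; lra.
Qed.

Definition derivative_distribution : schwartz_distribution R :=
  SchwartzDistribution derivative_functional_cvg.

Lemma derivative_distributionP : is_distr_derivative derivative_distribution F.
Proof. by []. Qed.

End DerivativeOfContinuous.
(** The argument is [(x - c) / r], in the affine form for which smoothness and the
    derivative are known. *)
Definition step_at c r x := smooth_step (r^-1 * x + - (r^-1 * c)).

Lemma smooth_step_at c r : smooth (step_at c r).
Proof.
by apply: smooth_comp; [exact: smooth_smooth_step | exact: smooth_affine].
Qed.

Lemma step_at_argE c r x : 0 < r -> r^-1 * x + - (r^-1 * c) = (x - c) / r.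
Proof. by move=> r0; rewrite -mulrBr mulrC. Qed.

Lemma step_at_left c r x : 0 < r -> x <= c -> step_at c r x = 0.
Proof.
move=> r0 xc; apply: smooth_step_le0.
by rewrite step_at_argE// pmulr_lle0 ?invr_gt0// subr_le0.
Qed.

Lemma step_at_right c r x : 0 < r -> c + r <= x -> step_at c r x = smooth_step 1.
Proof.
move=> r0 xc; apply: smooth_step_ge1.
by rewrite step_at_argE// ler_pdivlMr// mul1r lerBrDl.
Qed.

Lemma derive1_step_at_ge0 c r x : 0 < r -> 0 <= derive1 (step_at c r) x.
Proof.
move=> r0.
have d (y : R) : is_derive y 1 (step_at c r)
    (derive1 (@smooth_step R) (r^-1 * y + - (r^-1 * c)) * r^-1).
  apply: is_derive1_comp (is_derive1_affine _ _ _).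
  by apply: derivable_is_derive1; apply: smooth_derivable; exact: smooth_smooth_step.
by rewrite (is_derive1E d) mulr_ge0 ?derive1_smooth_step_ge0// invr_ge0 ltW.
Qed.

Lemma derive1_step_at_eq0 c r x :
  0 < r -> ~~ (c <= x <= c + r) -> derive1 (step_at c r) x = 0.
Proof.
move=> r0; rewrite negb_and -!ltNge => /orP[xc|xc].
  apply: (@near_cst_derive1 _ 0); near=> y; rewrite step_at_left//.
  by apply/ltW; near: y; exact: lt_nbhsl.
apply: (@near_cst_derive1 _ (smooth_step 1)); near=> y; rewrite step_at_right//.
by apply/ltW; near: y; exact: lt_nbhsr.
Unshelve. all: by end_near. Qed.

(** If [F - G] were larger at [a] than at [b], testing it against a smooth plateau
    that rises near [a] and descends near [b] would give a positive number. *)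
Lemma distr_derivative_le (u : schwartz_distribution R) F G a b :
  continuous F -> continuous G ->
  is_distr_derivative u F -> is_distr_derivative u G -> F a - G a <= F b - G b.
Proof.
move=> cF cG uF uG; rewrite leNgt; apply/negP => Dba.
pose D x := F x - G x; rewrite -/(D a) -/(D b) in Dba.
have cD : continuous D by move=> x; apply: cvgB; [exact: cF | exact: cG].
pose c := (D a + D b) / 2; pose d := (D a - D b) / 4.
have d0 : 0 < d by rewrite /d; lra.
have [r r0 [Da Db]] : exists2 r, 0 < r &
    (forall x, a <= x <= a + r -> d <= D x - c) /\
    (forall x, b <= x <= b + r -> D x - c <= 0).
  have /cvgrPdist_lt/(_ d d0)/nbhs_ballP[r1 /= r10 Dr1] := cD a.
  have /cvgrPdist_lt/(_ d d0)/nbhs_ballP[r2 /= r20 Dr2] := cD b.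
  exists (Num.min r1 r2 / 2); first by rewrite divr_gt0// lt_min r10.
  have m1 : Num.min r1 r2 <= r1 by rewrite ge_min lexx.
  have m2 : Num.min r1 r2 <= r2 by rewrite ge_min lexx orbT.
  have m0 : 0 < Num.min r1 r2 by rewrite lt_min r10.
  split=> x xr.
    have /ltr_normlP[_] : `|D a - D x| < d.
      by apply: Dr1; rewrite /ball/= ltr_distlC; apply/andP; split; lra.
    by rewrite /d /c; lra.
  have /ltr_normlP[+ _] : `|D b - D x| < d.
    by apply: Dr2; rewrite /ball/= ltr_distlC; apply/andP; split; lra.
  by rewrite /d /c; lra.
pose phi x := step_at a r x + -1 * step_at b r x.
have sphi : smooth phi.
  apply/smoothP => n; apply: smooth_uptoD.
    exact: (smoothP _).1 (@smooth_step_at a r) n.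
  apply: smooth_uptoM; first exact: smooth_upto_cst.
  exact: (smoothP _).1 (@smooth_step_at b r) n.
have dphi x : derive1 phi x = derive1 (step_at a r) x - derive1 (step_at b r) x.
  have da : is_derive x 1 (step_at a r) (derive1 (step_at a r) x).
    by apply: derivable_is_derive1; apply: smooth_derivable; exact: smooth_step_at.
  have db : is_derive x 1 (step_at b r) (derive1 (step_at b r) x).
    by apply: derivable_is_derive1; apply: smooth_derivable; exact: smooth_step_at.
  have dc : is_derive x 1 (fun=> -1 : R) (0 : R) by exact: is_derive_cst.
  have dm := is_derive1D da (is_derive1M dc db).
  by rewrite derive1E (@derive_val _ _ _ _ _ _ _ dm) /= mulr0 addr0 mulN1r.
pose M := `|a| + `|b| + r.
have [Ma Mb] : - M <= a /\ - M <= b.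
  by split; [have := lerNnormlW (lexx `|a|) | have := lerNnormlW (lexx `|b|)];
     rewrite /M; have := normr_ge0 a; have := normr_ge0 b; lra.
have [aM bM] : a + r <= M /\ b + r <= M.
  by rewrite /M; have := ler_norm a; have := ler_norm b;
     have := normr_ge0 a; have := normr_ge0 b; split; lra.
have phiL x : x <= - M -> phi x = 0.
  by move=> xM; rewrite /phi !step_at_left ?mulr0 ?addr0//; lra.
have phiR x : M <= x -> phi x = 0.
  by move=> Mx; rewrite /phi !step_at_right ?mulN1r ?subrr//; lra.
have phiM : null_outside M phi.
  move=> x; rewrite ltNge ler_norml negb_and -!ltNge => /orP[xM|Mx].
    by rewrite phiL// ltW.
  by rewrite phiR// ltW.
have phi_test : phi \in @test_pred R.
  rewrite unfold_in; apply/asboolP; split => //.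
  exists `[- M, M]; first exact: segment_compact.
  move=> x /= /negP xM; apply: phiM; rewrite ltNge ler_norml.
  by apply: contra xM; rewrite in_itv.
have := uF (TestFun phi_test); rewrite (uG (TestFun phi_test)) => /oppr_inj /esym.
rewrite !(@Rintegral_testfun M _ (TestFun phi_test))//=.
have cphi : continuous (derive1 phi).
  by apply: smooth_continuous; exact: smooth_derive1.
have MM : - M < M by rewrite /M; have := normr_ge0 a; have := normr_ge0 b; lra.
move=> /eqP; rewrite -subr_eq0 -RintegralB//; last 2 first.
- by apply: continuous_integrable_itv; exact: continuous_mul.
- by apply: continuous_integrable_itv; exact: continuous_mul.
move=> /eqP FG0.
(* [phi] has integral 0 against [D] by hypothesis and against constants because of
   its compact support, whereas [(D - c) phi'] is nonnegative and dominates [d]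
   times the derivative of the rising step. *)
have Dphi0 : \int[mu]_(x in `[- M, M]) (D x * derive1 phi x - c * derive1 phi x) = 0.
  rewrite RintegralB//; last 2 first.
  - by apply: continuous_integrable_itv; exact: continuous_mul.
  - by apply: continuous_integrable_itv; exact: continuous_cstM.
  rewrite RintegralZl//; last exact: continuous_integrable_itv.
  rewrite Rintegral_derive1// (phiL (- M))// (phiR M)// subrr mulr0 subr0.
  by rewrite -[RHS]FG0; apply: eq_Rintegral => x _; rewrite mulrBl.
have ca : continuous (derive1 (step_at a r)).
  by apply: smooth_continuous; apply: smooth_derive1; exact: smooth_step_at.
have : \int[mu]_(x in `[- M, M]) (d * derive1 (step_at a r) x) <= 0.
  rewrite -Dphi0; apply: le_Rintegral => //.
  - by apply: continuous_integrable_itv; exact: continuous_cstM.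
  - apply: continuous_integrable_itv => x; apply: cvgB.
      exact: (continuous_mul cD cphi).
    exact: (continuous_cstM cphi).
  move=> x _; rewrite -mulrBl dphi mulrBr lerBrDr.
  apply: (@le_trans _ _ (d * derive1 (step_at a r) x + 0)).
    rewrite lerD2l; have [xb|xb] := boolP (b <= x <= b + r).
      by rewrite mulr_le0_ge0 ?Db// derive1_step_at_ge0.
    by rewrite derive1_step_at_eq0// mulr0.
  rewrite addr0; have [xa|xa] := boolP (a <= x <= a + r).
    by rewrite ler_wpM2r ?Da// derive1_step_at_ge0.
  by rewrite derive1_step_at_eq0// !mulr0.
rewrite RintegralZl//; last exact: continuous_integrable_itv.
rewrite (Rintegral_derive1 MM (@smooth_step_at a r)).
rewrite step_at_right// step_at_left// subr0 leNgt mulr_gt0//.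
exact: smooth_step1_gt0.
Qed.

Lemma Bc_derivative_inj (u : schwartz_distribution R) F G :
  Bc F -> Bc G -> is_distr_derivative u F -> is_distr_derivative u G -> F = G.
Proof.
move=> [cF F0 _] [cG G0 _] uF uG; apply/funext => x.
have := distr_derivative_le x (- pi) cF cG uF uG.
have := distr_derivative_le (- pi) x cF cG uF uG.
by rewrite F0 G0 subrr subr_ge0 subr_le0 => ? ?; apply/eqP; rewrite eq_le; apply/andP.
Qed.

(** The value chosen by [primitive] can be computed because of the normalization
    [F (- pi) = 0], which removes the constant of integration. *)
Lemma primitiveE (u : schwartz_distribution R) F :
  Bc F -> is_distr_derivative u F -> primitive u = F.
Proof.
move=> BF uF; rewrite /primitive.
case: xgetP => [G _ [BG uG]|/(_ F)/=]; last by move=> /(_ (conj BF uF)).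
exact: Bc_derivative_inj uG uF.
Qed.

End Distributions.

(** * Riemann--Stieltjes integrals *)

Section Stieltjes.
Variable R : realType.
Implicit Types (F h g : R -> R) (a b c : R).

Lemma continuous_unif_itv F a b : continuous F -> forall e, 0 < e ->
  exists2 d, 0 < d & forall x y, a <= x <= b -> a <= y <= b ->
    `|x - y| < d -> `|F x - F y| < e.
Proof.
move=> cF e e0.
have /compact_near_coveringP cov := @segment_compact R a b.
have : \forall d \near (0 : R)^'+, `[a, b] `<=`
    [set x | forall y, `|x - y| < d -> `|F x - F y| < e].
  apply: cov => x _.
  have /cvgrPdist_lt/(_ (e / 2)) := cF x.
  rewrite divr_gt0// => /(_ isT)/nbhs_ballP[r /= r0 Fr].
  exists (ball x (r / 2), [set d | d < r / 2]).
    split=> /=; first by apply: nbhsx_ballx; rewrite divr_gt0.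
    by apply: nbhs_right_lt; rewrite divr_gt0.
  move=> [x' d] [/= xx' dr] y x'y.
  have := Fr x'; have := Fr y; rewrite /ball/= in xx' *.
  move=> /(_ _)Fy /(_ _)Fx.
  have {Fy} : `|F x - F y| < e / 2.
    apply: Fy; rewrite -[x - y](subrKA x').
    by rewrite (le_lt_trans (ler_normD _ _))//; lra.
  have {Fx} : `|F x - F x'| < e / 2 by apply: Fx; lra.
  rewrite -[F x' - F y](subrKA (F x)) [`|F x - F x'|]distrC => ? ?.
  by rewrite (le_lt_trans (ler_normD _ _))//; lra.
move=> /(filterI (nbhs_right_gt (0 : R)))/(@filter_ex _ _ _)[d /= [d0 Fd]].
by exists d => // x y xab yab; apply: Fd; rewrite /= in_itv.
Qed.

Lemma itv_partition_lt a b s i : itv_partition a b s -> (i < size s)%N ->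
  (a :: s)`_i < (a :: s)`_i.+1.
Proof. by move=> [/(pathP 0) + _]; apply. Qed.

Lemma itv_partition_itv a b s i : itv_partition a b s -> (i <= size s)%N ->
  a <= (a :: s)`_i <= b.
Proof.
move=> ps si; rewrite (set_nth_default b)//.
by rewrite itv_partition_nth_ge// itv_partition_nth_le.
Qed.

Lemma telescope_partition a b s h : itv_partition a b s ->
  \sum_(i < size s) (h (a :: s)`_i.+1 - h (a :: s)`_i) = h b - h a.
Proof.
move=> ps; rewrite -(big_mkord xpredT (fun i => h (a :: s)`_i.+1 - h (a :: s)`_i)).
by rewrite telescope_sumr// (itv_partition_nth_size _ ps).
Qed.

Section UniformPartition.
Variables (a b : R) (N : nat).

Definition unif_pt i : R := a + i%:R * ((b - a) / N%:R).

Definition unif_partition := mkseq (fun i => unif_pt i.+1) N.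

Lemma nth_unif_partition d i :
  (i <= N)%N -> nth d (a :: unif_partition) i = unif_pt i.
Proof.
case: i => [|i] iN; first by rewrite /unif_pt mul0r addr0.
by rewrite /= nth_mkseq.
Qed.

Hypotheses (ab : a < b) (N0 : (0 < N)%N).

Lemma unif_pt_lt i : unif_pt i < unif_pt i.+1.
Proof.
rewrite /unif_pt ltrD2l ltr_pM2r ?ltr_nat//.
by rewrite divr_gt0 ?ltr0n// subr_gt0.
Qed.

Lemma unif_pt_last : unif_pt N = b.
Proof. by rewrite /unif_pt mulrC divfK ?pnatr_eq0 -?lt0n// addrC subrK. Qed.

Lemma unif_partitionP : itv_partition a b unif_partition.
Proof.
split.
  apply/(pathP 0) => i; rewrite size_mkseq => iN.
  rewrite nth_unif_partition; last exact: ltnW.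
  by rewrite nth_mkseq// unif_pt_lt.
have -> : last a unif_partition = nth 0 (a :: unif_partition) N.
  by rewrite (last_nth 0) size_mkseq.
by rewrite nth_unif_partition// unif_pt_last.
Qed.

Lemma unif_partition_variation g :
  variation a b g unif_partition = \sum_(i < N) `|g (unif_pt i.+1) - g (unif_pt i)|.
Proof.
rewrite /variation size_mkseq big_mkord; apply: eq_bigr => i _ /=.
rewrite nth_mkseq// -[nth b (a :: _) i]/(nth b (a :: unif_partition) i).
by rewrite nth_unif_partition// ltnW.
Qed.

End UniformPartition.

(** Sums over uniform partitions tagged at left endpoints determine the integral,
    and are explicit enough to be estimated for dilated periodic integrators. *)
Lemma is_stieltjes_integral_unif a b F h v : a < b ->
  is_stieltjes_integral a b F h v -> forall e, 0 < e ->
  exists N0, forall N, (N0 <= N)%N -> (0 < N)%N ->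
    `|\sum_(i < N) F (unif_pt a b N i) *
        (h (unif_pt a b N i.+1) - h (unif_pt a b N i)) - v| < e.
Proof.
move=> ab Fhv e /Fhv[d d0 vd].
exists (Num.truncn ((b - a) / d)).+1 => N N0N N0.
have := vd (unif_partition a b N) (mkseq (unif_pt a b N) N).
rewrite /stieltjes_sum size_mkseq.
have -> : \sum_(i < N) F (mkseq (unif_pt a b N) N)`_i *
    (h (a :: unif_partition a b N)`_i.+1 - h (a :: unif_partition a b N)`_i) =
  \sum_(i < N) F (unif_pt a b N i) * (h (unif_pt a b N i.+1) - h (unif_pt a b N i)).
  apply: eq_bigr => i _.
  by rewrite !nth_unif_partition ?nth_mkseq// ltnW.
apply.
  split; [exact: unif_partitionP|by rewrite !size_mkseq|].
  move=> i; rewrite size_mkseq => iN.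
  rewrite !nth_unif_partition ?nth_mkseq//; last exact: ltnW.
  by rewrite lexx ltW// unif_pt_lt.
move=> i; rewrite size_mkseq => iN.
rewrite !nth_unif_partition//; last exact: ltnW.
rewrite /unif_pt opprD addrACA subrr add0r -mulrBl -natrB// subSnn mul1r.
rewrite ltr_pdivrMr ?ltr0n// mulrC -ltr_pdivrMr//.
by apply: lt_le_trans (truncnS_gt _) _; rewrite ler_nat.
Qed.

Lemma is_stieltjes_integral_unique a b F h v w : a < b ->
  is_stieltjes_integral a b F h v -> is_stieltjes_integral a b F h w -> v = w.
Proof.
move=> ab Fv Fw; apply/eqP; rewrite -subr_eq0 -normr_le0 leNgt; apply/negP => vw.
have vw2 : 0 < `|v - w| / 2 by rewrite divr_gt0.
have [N1 FN1] := is_stieltjes_integral_unif ab Fv vw2.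
have [N2 FN2] := is_stieltjes_integral_unif ab Fw vw2.
have Sv := FN1 _ (leqW (leq_addr N2 N1)) isT.
have Sw := FN2 _ (leqW (leq_addl N1 N2)) isT.
move: Sv Sw; set S := \sum_(i < _) _; rewrite [`|S - v|]distrC => Sv Sw.
by have := ler_normD (v - S) (S - w); rewrite subrKA; lra.
Qed.

Lemma stieltjes_integralE a b F h v : a < b ->
  is_stieltjes_integral a b F h v -> stieltjes_integral a b F h = v.
Proof.
move=> ab Fv; rewrite /stieltjes_integral; case: xgetP => [w _ /= Fw|/(_ v)//].
exact: is_stieltjes_integral_unique Fw Fv.
Qed.

Lemma eq_is_stieltjes_integral a b F h1 h2 v :
  (forall x, a <= x <= b -> h1 x = h2 x) ->
  is_stieltjes_integral a b F h1 v -> is_stieltjes_integral a b F h2 v.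
Proof.
move=> h12 Fv e /Fv[d d0 vd]; exists d => // s xi ts ms.
suff -> : stieltjes_sum F h2 a s xi = stieltjes_sum F h1 a s xi by exact: vd.
have [ps _ _] := ts.
apply: eq_bigr => i _; have lti := ltn_ord i.
by rewrite !h12//; apply: itv_partition_itv ps _ => //; exact: ltnW.
Qed.

Lemma is_stieltjes_integralD a b F h1 h2 v1 v2 :
  is_stieltjes_integral a b F h1 v1 -> is_stieltjes_integral a b F h2 v2 ->
  is_stieltjes_integral a b F (fun x => h1 x + h2 x) (v1 + v2).
Proof.
move=> F1 F2 e e0; have e2 : 0 < e / 2 by rewrite divr_gt0.
have [d1 d10 v1d] := F1 _ e2; have [d2 d20 v2d] := F2 _ e2.
exists (Num.min d1 d2) => [|s xi ts ms]; first by rewrite lt_min d10.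
have m1 : mesh_lt a s d1 by move=> i /ms; rewrite lt_min => /andP[].
have m2 : mesh_lt a s d2 by move=> i /ms; rewrite lt_min => /andP[].
have -> : stieltjes_sum F (fun x => h1 x + h2 x) a s xi =
    stieltjes_sum F h1 a s xi + stieltjes_sum F h2 a s xi.
  by rewrite -big_split; apply: eq_bigr => i _ /=; ring.
have := v1d _ _ ts m1; have := v2d _ _ ts m2.
rewrite opprD addrACA => ? ?.
by rewrite (le_lt_trans (ler_normD _ _))//; lra.
Qed.

Lemma is_stieltjes_integralZ a b F h v (k : R) :
  is_stieltjes_integral a b F h v ->
  is_stieltjes_integral a b F (fun x => k * h x) (k * v).
Proof.
move=> Fv e e0.
have [d d0 vd] := Fv (e / (`|k| + 1)) (divr_gt0 e0 (ltr_wpDl (normr_ge0 k) ltr01)).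
exists d => // s xi ts ms.
have -> : stieltjes_sum F (fun x => k * h x) a s xi = k * stieltjes_sum F h a s xi.
  by rewrite mulr_sumr; apply: eq_bigr => i _; ring.
rewrite -mulrBr normrM; have := vd _ _ ts ms.
rewrite ltr_pdivlMr ?ltr_wpDl//; apply: le_lt_trans.
by rewrite mulrC ler_wpM2l// lerDl.
Qed.

Lemma is_stieltjes_integral_cst a b F (k : R) :
  is_stieltjes_integral a b F (fun=> k) 0.
Proof.
move=> e e0; exists 1 => // s xi _ _.
by rewrite /stieltjes_sum big1 ?subr0 ?normr0// => i _; rewrite subrr mulr0.
Qed.

Lemma is_stieltjes_integral_sum a b F (h : nat -> R -> R) (v : nat -> R) n :
  (forall i, (i < n)%N -> is_stieltjes_integral a b F (h i) (v i)) ->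
  is_stieltjes_integral a b F (fun x => \sum_(i < n) h i x) (\sum_(i < n) v i).
Proof.
elim: n => [|n IHn] Fh.
  rewrite big_ord0; apply: eq_is_stieltjes_integral (is_stieltjes_integral_cst a b F 0).
  by move=> x _; rewrite big_ord0.
rewrite big_ord_recr/=.
apply: eq_is_stieltjes_integral (is_stieltjes_integralD (IHn _) (Fh n _)) => //.
  by move=> x _; rewrite big_ord_recr.
by move=> i iN; apply: Fh; exact: ltnW.
Qed.

(** Only the cell that contains [c] contributes, and its tag is close to [c]. *)
Lemma is_stieltjes_integral_heaviside a b F c : continuous F -> a < c <= b ->
  is_stieltjes_integral a b F (fun x => (c <= x)%R%:R) (F c).
Proof.
move=> cF /andP[ac cb] e e0.
have /cvgrPdist_lt/(_ (e / 2)) := cF c.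
rewrite divr_gt0// => /(_ isT)/nbhs_ballP[d /= d0 Fd].
exists d => // s xi [ps _ xiP] ms.
pose H (x : R) : R := (c <= x)%R%:R.
have -> : stieltjes_sum F H a s xi - F c = \sum_(i < size s)
    (F xi`_i - F c) * (H (a :: s)`_i.+1 - H (a :: s)`_i).
  rewrite -[X in _ - X]mulr1.
  have <- : H b - H a = 1 by rewrite /H cb leNgt ac subr0.
  rewrite -(telescope_partition H ps) mulr_sumr /stieltjes_sum -sumrB.
  by apply: eq_bigr => i _; rewrite mulrBl.
apply: (@le_lt_trans _ _ (\sum_(i < size s) e / 2 * (H (a :: s)`_i.+1 - H (a :: s)`_i))).
  apply: le_trans (ler_norm_sum _ _ _) _; apply: ler_sum => i _.
  have si := itv_partition_lt ps (ltn_ord i).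
  have mi := ms _ (ltn_ord i).
  have /andP[xl xr] := xiP _ (ltn_ord i).
  rewrite /H; have [cs|cs] := leP c (a :: s)`_i.
    by rewrite (le_trans cs (ltW si)) subrr !mulr0 normr0.
  have [cs'|cs'] := leP c (a :: s)`_i.+1; last by rewrite subrr !mulr0 normr0.
  rewrite subr0 !mulr1 ltW// distrC; apply: Fd.
  rewrite /ball/= ltr_distlC; apply/andP; split; lra.
rewrite -mulr_sumr (telescope_partition H ps) /H cb [c <= a]leNgt ac subr0 mulr1.
by rewrite ltr_pdivrMr// mulr_natr mulr2n ltrDl.
Qed.

End Stieltjes.

(** * The upper bound *)

Section UpperBound.
Variable R : realType.
Implicit Types (F g : R -> R) (u v : nat -> R).

Lemma sum_shift_periodic v m c : (forall i, v (i + m)%N = v i) ->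
  \sum_(i < m) v (i + c)%N = \sum_(i < m) v i.
Proof.
move=> vm; elim: c => [|c IHc]; first by apply: eq_bigr => i _; rewrite addn0.
rewrite -{}IHc; case: m vm => [|m] vm; first by rewrite !big_ord0.
rewrite big_ord_recr big_ord_recl/= addrC; congr (_ + _).
  by rewrite add0n addnS -addSn addnC vm.
by apply: eq_bigr => i _; rewrite /bump/= add1n addSnnS.
Qed.

(** Over each period the increments of [v] cancel, so [u] may be replaced there by
    its difference from its value at the start of the period. *)
Lemma periodic_increments_bound u v m e n :
  (forall i, v (i + m)%N = v i) ->
  (forall k j, (k < n)%N -> (j < m)%N -> `|u (k * m + j)%N - u (k * m)%N| <= e) ->
  `|\sum_(i < n * m) u i * (v i.+1 - v i)| <=
    n%:R * (e * \sum_(j < m) `|v j.+1 - v j|).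
Proof.
move=> vm; elim: n => [|n IHn] ue.
  by rewrite mul0n big_ord0 normr0 mul0r.
have vkm k j : v (k * m + j)%N = v j.
  elim: k => [|k IHk]; first by rewrite mul0n.
  by rewrite mulSn -addnA addnC vm.
rewrite mulSn addnC big_split_ord/= -natr1 mulrDl mul1r.
rewrite (le_trans (ler_normD _ _))// lerD//.
  by apply: IHn => k j kn; apply: ue; exact: ltnW.
have -> : \sum_(j < m) u (n * m + j)%N * (v (n * m + j).+1 - v (n * m + j)%N) =
    \sum_(j < m) (u (n * m + j)%N - u (n * m)%N) * (v j.+1 - v j).
  have v0 : \sum_(j < m) (v j.+1 - v j) = 0.
    rewrite -(big_mkord xpredT (fun j => v j.+1 - v j)) telescope_sumr//.
    by rewrite -[m]add0n vm subrr.
  under [RHS]eq_bigr do rewrite mulrBl.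
  rewrite sumrB -mulr_sumr v0 mulr0 subr0.
  by apply: eq_bigr => j _; rewrite -addnS !vkm.
rewrite (le_trans (ler_norm_sum _ _ _))// mulr_sumr ler_sum// => j _.
by rewrite normrM ler_wpM2r// ue.
Qed.

Lemma periodic_natpi g n : periodic g (2 * pi) ->
  `|g (n%:R * pi)| <= `|g 0| + `|g pi|.
Proof.
move=> pg; have -> : n%:R * pi = (odd n)%:R * pi + 2 * pi *+ n./2 :> R.
  rewrite -{1}(odd_double_half n) natrD mulrDl -[_ *+ n./2]mulr_natl.
  by rewrite -mul2n natrM mulrA [_%:R * 2]mulrC.
rewrite periodicn//; case: (odd n); rewrite ?mul1r ?mul0r.
  by rewrite lerDr.
by rewrite lerDl.
Qed.

(** Each of the [n.+1] periods of the integrator contributes at most [e * V]: its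
    increments add up to 0 and [F] varies by at most [e] along it. *)
Lemma stieltjes_dilation_bound F g (V e w : R) n :
  periodic g (2 * pi) -> ubound (variations (- pi) pi g) V ->
  (forall x y : R, - pi <= x <= pi -> - pi <= y <= pi ->
     `|x - y| < 2 * pi / n.+1%:R -> `|F x - F y| <= e) ->
  is_stieltjes_integral (- pi) pi F (fun t => g (n.+1%:R * t)) w ->
  `|w| <= n.+1%:R * (e * V).
Proof.
move=> pg gV Fe Fv; have pi0 : 0 < pi :> R := pi_gt0 R.
have pipi : - pi < pi :> R by lra.
apply/ler_addgt0Pr => d d0.
have [N0 FN0] := is_stieltjes_integral_unif pipi Fv d0.
have N0N : (N0 <= n.+1 * (2 * N0.+1))%N by lia.
have := FN0 _ N0N isT.
(* With an even number [m] of cells per period, the arguments of [g], which start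
   from [- n.+1 * pi], lie on the grid of step [2 * pi / m] through [- pi], where
   the variation of [g] is known. *)
set m := (2 * N0.+1)%N; set N := (n.+1 * m)%N.
set h := (fun t => g (n.+1%:R * t)).
set S := \sum_(i < N) _ => Sv.
have m0 : m%:R != 0 :> R by rewrite pnatr_eq0.
have n0 : n.+1%:R != 0 :> R by rewrite pnatr_eq0.
have N10 : N0.+1%:R != 0 :> R by rewrite pnatr_eq0.
have mE : m%:R = 2 * N0.+1%:R :> R by rewrite natrM.
have NE : N%:R = n.+1%:R * m%:R :> R by rewrite natrM.
pose gr i := g (unif_pt (- pi) pi m i).
have grm i : gr (i + m)%N = gr i.
  rewrite /gr -[RHS]pg; congr g; rewrite /unif_pt natrD; field.
  exact: m0.
have hgr i : h (unif_pt (- pi) pi N i) = gr (i + n * N0.+1)%N.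
  rewrite /gr /h -[LHS](periodicn pg n); congr g.
  rewrite /unif_pt NE mE natrD natrM -mulr_natr -natr1; field.
  by rewrite [1 + _]addrC !natr1 N10 n0.
suff SV : `|S| <= n.+1%:R * (e * V).
  have := ler_normB S (S - w); rewrite opprB addrC subrK; lra.
have vm i : h (unif_pt (- pi) pi N (i + m)%N) = h (unif_pt (- pi) pi N i).
  by rewrite !hgr addnAC grm.
apply: (@le_trans _ _ (n.+1%:R * (e * \sum_(j < m)
    `|h (unif_pt (- pi) pi N j.+1) - h (unif_pt (- pi) pi N j)|))).
  apply: (periodic_increments_bound (u := fun i => F (unif_pt (- pi) pi N i))
    (v := fun i => h (unif_pt (- pi) pi N i)) vm).
  move=> k j kn jm.
  have itv i : (i <= N)%N -> (- pi : R) <= unif_pt (- pi) pi N i <= (pi : R).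
    have N_gt0 : (0 < N)%N by rewrite muln_gt0.
    have := @itv_partition_itv _ _ _ _ i (unif_partitionP pipi N_gt0).
    by rewrite size_mkseq => + iN => /(_ iN); rewrite nth_unif_partition.
  have kjN : (k * m + j <= N)%N by rewrite /N; nia.
  apply: Fe; [exact: itv | apply: itv; lia |].
  have -> : unif_pt (- pi) pi N (k * m + j) - unif_pt (- pi) pi N (k * m) =
      2 * pi / n.+1%:R * (j%:R / m%:R) :> R.
    by rewrite /unif_pt NE natrD; field; rewrite m0 [1 + _]addrC natr1 n0.
  have q0 : 0 < 2 * pi / n.+1%:R :> R by rewrite divr_gt0 ?mulr_gt0.
  rewrite ger0_norm; last by apply: mulr_ge0; [exact: ltW | exact: divr_ge0].
  by rewrite gtr_pMr// ltr_pdivrMr ?ltr0n// mul1r ltr_nat.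
have e0 : 0 <= e.
  have pp : - pi <= (- pi : R) <= pi by lra.
  apply: le_trans (Fe _ _ pp pp _); first exact: normr_ge0.
  by rewrite subrr normr0 divr_gt0 ?mulr_gt0.
rewrite ler_wpM2l// ler_wpM2l//.
pose b j := `|gr j.+1 - gr j|.
have -> : \sum_(j < m) `|h (unif_pt (- pi) pi N j.+1) -
      h (unif_pt (- pi) pi N j)| =
    \sum_(j < m) b (j + n * N0.+1)%N.
  by apply: eq_bigr => j _; rewrite !hgr.
rewrite (sum_shift_periodic (v := b)); last by move=> i; rewrite /b -addSn !grm.
rewrite /b /gr -unif_partition_variation; apply: gV.
by apply: variations_variation; exact: unif_partitionP.
Qed.

(** Uniform continuity of [F] makes the oscillation over one period of [g (n t)], of
    length [2 * pi / n], as small as wanted. *)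
Lemma cp_integral_dilation_littleo (f : schwartz_distribution R) g :
  Ac f -> BVT g ->
  (fun n : nat => cp_integral f (fun t : R => g (n%:R * t)))
    =o_\oo (fun n : nat => n%:R : R).
Proof.
move=> [F0 BF0 fF0] [pg [V gV]]; apply/eqoP => e e0.
rewrite /cp_integral (primitiveE BF0 fF0); move: BF0 => [cF _ _].
set F := F0 in cF *.
have pi0 : 0 < pi :> R := pi_gt0 R.
have V0 : 0 <= V.
  have pipi : - pi < pi :> R by lra.
  apply: le_trans (gV _ (variations_variation g (itv_partition1 pipi))).
  exact: variation_ge0.
pose d := e / (2 * (V + 1)).
have d0 : 0 < d by rewrite divr_gt0 ?mulr_gt0 ?ltr_wpDl.
have [r r0 Fr] := @continuous_unif_itv R F (- pi) pi cF d d0.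
pose C := `|F pi| * (`|g 0| + `|g pi|).
near=> n.
have n1 : (0 < n)%N by near: n; exists 1%N.
have n0 : 0 < n%:R :> R by rewrite ltr0n.
have nr : 2 * pi / r < n%:R by near: n; exact: nbhs_infty_gtr.
have nC : 2 * C / e <= n%:R by near: n; exact: nbhs_infty_ger.
have Cn : C <= e / 2 * n%:R by move: nC; rewrite ler_pdivrMr//; lra.
have Sn : `|stieltjes_integral (- pi) pi F (fun t => g (n%:R * t))| <= n%:R * (d * V).
  (* The default value 0 of the integral obeys the bound too. *)
  rewrite /stieltjes_integral; case: xgetP => [w _ /= Fw|_]; last first.
    rewrite normr0; apply: mulr_ge0; first exact: ltW.
    by apply: mulr_ge0 => //; exact: ltW.
  have nE : n = n.-1.+1 by rewrite prednK.
  rewrite nE in Fw *; apply: (stieltjes_dilation_bound pg gV _ Fw) => x y xpi ypi.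
  rewrite -nE => xy; apply/ltW/Fr => //; apply: lt_trans xy _.
  by rewrite ltr_pdivrMr// [r * _]mulrC -ltr_pdivrMr.
have Fn : `|F pi * g (n%:R * pi)| <= C.
  by rewrite normrM ler_wpM2l// periodic_natpi.
rewrite (le_trans (ler_normB _ _))// (ger0_norm (ltW n0)).
have dV : d * V <= e / 2.
  rewrite /d invfM mulrA -mulrA ler_piMr ?divr_ge0 ?(ltW e0)//.
  by rewrite mulrC ler_pdivrMr ?ltr_wpDl// mul1r lerDl.
have := ler_wpM2l (ltW n0) dV; lra.
Unshelve. all: by end_near. Qed.

End UpperBound.

(** * The square wave *)

Section SquareWave.
Variable R : realType.
Implicit Types (F : R -> R) (t x : R).

Definition square_wave t : R := (-1) ^ Num.floor (t / pi).

Lemma square_wave_periodic : periodic square_wave (2 * pi).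
Proof.
move=> t; rewrite /square_wave mulrDl mulfK ?gt_eqF ?pi_gt0//.
have -> : Num.floor (t / pi + 2) = Num.floor (t / pi) + 2 :> int.
  by rewrite floorDrz ?intrEge// ?natr_int//; congr (_ + _); exact: (@intrKfloor R 2).
by rewrite expfzDr ?oppr_eq0 ?oner_eq0// [_ ^ 2]sqrrN expr1n mulr1.
Qed.

(** Bounds the variation of [square_wave] by that of the monotone exponent. *)
Lemma dist_exprzN1 (p q : int) : p <= q ->
  `|(-1) ^ q - (-1) ^ p| <= 2 * (q%:~R - p%:~R) :> R.
Proof.
rewrite le_eqVlt => /predU1P[->|pq]; first by rewrite !subrr normr0 mulr0.
have N1 (r : int) : `|(-1) ^ r| = 1 :> R.
    by case: r => k; rewrite /exprz ?normfV normrX normrN1 expr1n ?invr1.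
apply: (le_trans (ler_normB _ _)); rewrite !N1 -mulr2n -[leLHS]mulr_natr mul1r.
by rewrite ler_peMr// -rmorphB/= ler1z; lia.
Qed.

Lemma square_wave_BVT : BVT square_wave.
Proof.
split; first exact: square_wave_periodic.
pose fl t : R := (Num.floor (t / pi))%:~R.
have fl_homo : {homo fl : x y / x <= y}.
  by move=> x y xy; rewrite /fl ler_int le_floor// ler_pM2r ?invr_gt0 ?pi_gt0.
exists (2 * (fl pi - fl (- pi))) => _ [s ps <-].
rewrite -(@nondecreasing_variation _ _ _ fl _ _ ps); last first.
  by move=> x y _ _; exact: fl_homo.
rewrite /variation mulr_sumr; apply: ler_sum_nat => i /= si.
have xy := ltW (pathP pi ps.1 i si).
set x := nth pi (- pi :: s) i in xy *; set y := nth pi s i in xy *.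
rewrite (ger0_norm (_ : 0 <= fl y - fl x)) ?subr_ge0 ?fl_homo//.
by apply: dist_exprzN1; rewrite le_floor// ler_pM2r ?invr_gt0 ?pi_gt0.
Qed.

Lemma sum_sign_lt q N :
  1 + \sum_(i < N) (2 * (-1) ^+ i.+1 * ((i < q)%N)%:R) = (-1) ^+ (minn q N) :> R.
Proof.
elim: N => [|N IHN]; first by rewrite big_ord0 minn0 addr0.
rewrite big_ord_recr/= addrA IHN; case: (ltnP N q) => Nq.
  by rewrite (minn_idPr Nq) mulr1 exprS; ring.
by rewrite mulr0 addr0 (minn_idPl (leqW Nq)).
Qed.

(** [square_wave (n t)] jumps at the points of the uniform partition of
    [[- pi, pi]] into [2 n] cells. *)
Lemma square_wave_dilationE n t : (0 < n)%N -> - pi <= t <= pi ->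
  square_wave (n%:R * t) = (-1) ^+ n *
    (1 + \sum_(i < n.*2)
      2 * (-1) ^+ i.+1 * (unif_pt (- pi) pi n.*2 i.+1 <= t)%R%:R).
Proof.
move=> n0 /andP[tl tr]; have pi0 : 0 < pi :> R := pi_gt0 R.
have nR0 : 0 < n%:R :> R by rewrite ltr0n.
pose x := n%:R * t / pi + n%:R.
have xE : x = n%:R * (t + pi) / pi by rewrite /x; field; lra.
have x0 : 0 <= x by rewrite xE divr_ge0 ?(ltW pi0)// mulr_ge0 ?(ltW nR0)//; lra.
have x2n : x <= n.*2%:R.
  rewrite xE ler_pdivrMr// -muln2 natrM -mulrA ler_pM2l//; lra.
(* [q] jumps occur in [(- pi, t]]. *)
pose q := Num.truncn x.
have /andP[qx xq] : q%:R <= x < q.+1%:R by exact: truncn_itv.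
have q2n : (q <= n.*2)%N by rewrite -(ler_nat R) (le_trans qx).
have nE : n.*2%:R = n%:R * 2 :> R by rewrite -muln2 natrM.
have -> : \sum_(i < n.*2)
      2 * (-1) ^+ i.+1 * (unif_pt (- pi) pi n.*2 i.+1 <= t)%R%:R =
    \sum_(i < n.*2) (2 * (-1) ^+ i.+1 * ((i < q)%N)%:R) :> R.
  apply: eq_bigr => i _; congr (_ * (nat_of_bool _)%:R).
  rewrite truncn_ge_nat// xE /unif_pt ler_pdivlMr//.
  have -> : - pi + i.+1%:R * ((pi - - pi) / n.*2%:R) = i.+1%:R * pi / n%:R - pi :> R.
    by rewrite [n.*2%:R]nE; field; rewrite gt_eqF.
  by rewrite lerBlDr ler_pdivrMr// [n%:R * _]mulrC.
rewrite sum_sign_lt (minn_idPl q2n) /square_wave.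
have -> : Num.floor (n%:R * t / pi) = q%:Z - n%:Z.
  have qnE : (q%:Z - n%:Z)%:~R = q%:R - n%:R :> R by rewrite intrB !pmulrn.
  apply: floor_def; rewrite [(_ + 1)%:~R]intrD qnE.
  by move: qx xq; rewrite /x -natr1 => ? ?; apply/andP; split; lra.
by rewrite expfzDr ?oppr_eq0 ?oner_eq0// -exprz_inv invrN1 mulrC.
Qed.

Lemma is_stieltjes_integral_square_wave F n : continuous F -> (0 < n)%N ->
  is_stieltjes_integral (- pi) pi F (fun t => square_wave (n%:R * t))
    ((-1) ^+ n * (2 * \sum_(i < n.*2)
      (-1) ^+ i.+1 * F (unif_pt (- pi) pi n.*2 i.+1))).
Proof.
move=> cF n0; have pipi : - pi < pi :> R by have := pi_gt0 R; lra.
have n20 : (0 < n.*2)%N by rewrite double_gt0.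
pose H i t : R := 2 * (-1) ^+ i.+1 * (unif_pt (- pi) pi n.*2 i.+1 <= t)%R%:R.
apply: (@eq_is_stieltjes_integral _ _ _ _
  (fun t => (-1) ^+ n * (1 + \sum_(i < n.*2) H i t))).
  by move=> t tpi; rewrite square_wave_dilationE.
apply: is_stieltjes_integralZ; rewrite -[X in is_stieltjes_integral _ _ _ _ X]add0r.
apply: is_stieltjes_integralD; first exact: is_stieltjes_integral_cst.
rewrite mulr_sumr; under eq_bigr do rewrite mulrA.
apply: (@is_stieltjes_integral_sum _ _ _ _ H
  (fun i => 2 * (-1) ^+ i.+1 * F (unif_pt (- pi) pi n.*2 i.+1))) => i i2n.
apply: is_stieltjes_integralZ; apply: is_stieltjes_integral_heaviside => //.
rewrite -{1}[- pi](_ : unif_pt (- pi) pi n.*2 0 = _); last by rewrite /unif_pt mul0r addr0.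
have unif_lt : {homo unif_pt (- pi) pi n.*2 : i j / (i < j)%N >-> i < j :> R}.
  by apply: homo_ltn; [exact: lt_trans | move=> k; exact: unif_pt_lt].
rewrite unif_lt//= -[leRHS](unif_pt_last (- pi) pi n20).
by move: i2n; rewrite leq_eqVlt => /predU1P[->//|/unif_lt/ltW].
Qed.

End SquareWave.

(** * A lacunary primitive and sharpness *)

Section LacunarySeries.
Variable R : realType.
Implicit Types (x t : R) (J : nat -> nat).

Lemma sum_geometric_half_le m n :
  \sum_(m <= k < n) 2 * (2^-1 : R) ^+ k <= 4 * 2^-1 ^+ m.
Proof.
have [mn|nm] := leqP m n; last first.
  by rewrite big_geq 1?ltnW// mulr_ge0// exprn_ge0// invr_ge0.
have -> : \sum_(m <= k < n) 2 * (2^-1 : R) ^+ k = 4 * 2^-1 ^+ m - 4 * 2^-1 ^+ n.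
  elim: n mn => [|n IHn]; first by rewrite leqn0 => /eqP->; rewrite big_geq ?subrr.
  rewrite leq_eqVlt => /predU1P[->|mn]; first by rewrite big_geq ?subrr.
  by rewrite big_nat_recr//= IHn// !exprS; field.
by rewrite gerBl mulr_ge0// exprn_ge0// invr_ge0.
Qed.

Section GeometricMajorant.
Variable u : nat -> R -> R.
Hypothesis uk : forall k t, `|u k t| <= 2 * 2^-1 ^+ k.

Definition function_series t : R := limn (series (u ^~ t)).

Lemma cvg_function_series t : series (u ^~ t) @ \oo --> function_series t.
Proof.
apply: normed_cvg; apply: (@series_le_cvg _ _ (geometric 2 2^-1)) => [k|k|k|].
- exact: normr_ge0.
- by rewrite /= mulr_ge0// exprn_ge0// invr_ge0.
- exact: uk.
- by apply: is_cvg_geometric_series; rewrite ger0_norm ?invr_ge0// invf_lt1// ltr1n.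
Qed.

Lemma function_series_tail t n :
  `|function_series t - series (u ^~ t) n| <= 4 * 2^-1 ^+ n.
Proof.
have c : `|series (u ^~ t) m - series (u ^~ t) n| @[m --> \oo] -->
    `|function_series t - series (u ^~ t) n|.
  by apply: cvg_norm; apply: cvgB; [exact: cvg_function_series | exact: cvg_cst].
rewrite -(cvg_lim _ c)//; apply: limr_le; first exact: cvgP c.
exists n => // m /= nm.
rewrite sub_series_geq// (le_trans (ler_norm_sum _ _ _))//.
by apply: le_trans (sum_geometric_half_le n m); apply: ler_sum.
Qed.

Lemma continuous_function_series :
  (forall k, continuous (u k)) -> continuous function_series.
Proof.
move=> cu t; apply/cvgrPdist_lt => e e0.
(* Split at a partial sum, which is continuous, with tails below [e / 3]. *)
have [n un] : exists n, 4 * 2^-1 ^+ n < e / 3 :> R.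
  have /cvgrPdist_lt/(_ (e / 3)) : geometric 4 2^-1 @ \oo --> (0 : R).
    by apply: cvg_geometric; rewrite ger0_norm ?invr_ge0// invf_lt1// ltr1n.
  rewrite divr_gt0// => /(_ isT)[n _ /(_ n (leqnn n))] /=.
  rewrite sub0r normrN ger0_norm; last by rewrite mulr_ge0// exprn_ge0// invr_ge0.
  by exists n.
have cS : continuous (fun x => series (u ^~ x) n).
  move=> x; rewrite /series/=; apply: cvg_big => [|k _]; first exact: add_continuous.
  exact: cu.
have /cvgrPdist_lt/(_ (e / 3)) := cS t; rewrite divr_gt0// => /(_ isT).
apply: filterS => x Sx.
have := function_series_tail t n; have := function_series_tail x n.
set St := series _ n in Sx *; set Sx' := series _ n in Sx *.
set ft := function_series t; set fx := function_series x => fSx fSt.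
have -> : ft - fx = (ft - St) + (St - Sx') - (fx - Sx') by ring.
rewrite (le_lt_trans (ler_normB _ _))//.
by have := ler_normD (ft - St) (St - Sx'); lra.
Qed.

End GeometricMajorant.

Lemma cos_periodic : periodic (@cos R) (2 * pi).
Proof. by move=> t; rewrite mulr_natl cosD2pi. Qed.

Lemma cos_natpi k : cos (k%:R * pi : R) = (-1) ^+ k.
Proof.
elim: k => [|k IHk]; first by rewrite mul0r cos0.
by rewrite -natr1 mulrDl mul1r cosDpi IHk exprS mulN1r.
Qed.

Lemma periodic_int (f : R -> R) T (n : int) x : periodic f T -> f (x + n%:~R * T) = f x.
Proof.
move=> fT; case: n => n; first by rewrite -pmulrn mulr_natl periodicn.
rewrite NegzE mulrNz mulNr -[LHS](periodicn fT n.+1) -pmulrn mulr_natl.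
by rewrite subrK.
Qed.

(** The constant makes the function vanish at [- pi] and [pi] when [0 < l]. *)
Definition oscillation l t : R := cos (2 ^+ l * t) - 1.

Lemma oscillation_periodic l : periodic (oscillation l) (2 * pi).
Proof.
move=> t; rewrite /oscillation mulrDr -natrX [_%:R * (2 * _)]mulr_natl.
by rewrite (periodicn cos_periodic).
Qed.

Lemma oscillation_bound l t : `|oscillation l t| <= 2.
Proof.
rewrite ler_norml /oscillation.
by have := cos_le1 (2 ^+ l * t); have := cos_geN1 (2 ^+ l * t); lra.
Qed.

Lemma continuous_oscillation l : continuous (oscillation l).
Proof.
move=> t; apply: cvgB; last exact: cvg_cst.
apply: (@continuous_comp _ _ _ (fun t => 2 ^+ l * t) cos); last exact: continuous_cos.
exact: mulrl_continuous.
Qed.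

Lemma oscillation_unif_pt j l i : (0 < l)%N ->
  oscillation l (unif_pt (- pi) pi (2 ^ j).*2 i) =
  cos (i%:R * (2 ^+ l / 2 ^+ j) * pi) - 1.
Proof.
case: l => // l _; rewrite /oscillation; congr (_ - 1).
rewrite -[LHS](periodicn cos_periodic (2 ^ l)); congr cos.
rewrite /unif_pt -[_ *+ (2 ^ l)]mulr_natl -muln2 natrM !natrX exprS.
by field; rewrite expf_neq0.
Qed.

(** Shifting the index by [p] changes the sign of the sum, yet preserves a sum over
    whole periods. *)
Lemma sum_antiperiodic (b : nat -> R) p r : (forall i, b (i + p)%N = - b i) ->
  \sum_(i < r * (2 * p)) b i = 0.
Proof.
move=> bp.
have bN i : b (i + r * (2 * p))%N = b i.
  elim: r => [|r IHr]; first by rewrite mul0n addn0.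
  by rewrite mulSn addnCA mul2n -addnn addnC addnA !bp opprK addnn -mul2n.
have := sum_shift_periodic p bN.
under eq_bigr do rewrite bp.
by rewrite sumrN => /eqP; rewrite eq_sym -addr_eq0 -mulr2n mulrn_eq0 => /eqP.
Qed.

Lemma sum_sign_double N : \sum_(i < N.*2) (-1) ^+ i.+1 = 0 :> R.
Proof.
have := @sum_antiperiodic (fun i => (-1) ^+ i.+1) 1 N.
by rewrite muln1 muln2; apply => i; rewrite addn1 exprS mulN1r.
Qed.

(** At the half-periods of the wave of frequency [2 ^ j], waves of higher dyadic
    frequency are constant, and those of lower frequency change sign after
    [2 ^ (j - l)] points: neither contributes to the alternating sum. *)
Lemma alternating_sum_oscillation j l : (0 < l)%N ->
  \sum_(i < (2 ^ j).*2) (-1) ^+ i.+1 *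
    oscillation l (unif_pt (- pi) pi (2 ^ j).*2 i.+1) =
  ((l == j) * (2 ^ j).*2)%:R.
Proof.
move=> l0; under eq_bigr do rewrite oscillation_unif_pt// mulrBr mulr1.
rewrite sumrB sum_sign_double subr0.
have [lj|jl|->] := ltngtP l j.
- rewrite mul0n.
  have p2 : (2 ^ (j - l))%N%:R != 0 :> R by rewrite pnatr_eq0 expn_eq0.
  have -> : (2 ^ j).*2 = (2 ^ l * (2 * 2 ^ (j - l)))%N.
    by rewrite mulnCA -expnD subnKC ?mul2n// ltnW.
  have -> : 2 ^+ l / 2 ^+ j = (2 ^ (j - l))%N%:R^-1 :> R.
    by rewrite natrX -{1}(subnKC (ltnW lj)) exprD invfM mulrA divff ?mul1r//.
  apply: (sum_antiperiodic (b := fun i => (-1) ^+ i.+1 * cos (i.+1%:R * _ * pi))) => i.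
  rewrite -addSn natrD !mulrDl divff// mul1r cosDpi mulrN; congr (- (_ * _)).
  rewrite exprD -[X in _ * X]signr_odd oddX orbF.
  by rewrite subn_eq0 leqNgt lj mulr1.
- rewrite mul0n -[RHS](sum_sign_double (2 ^ j)); apply: eq_bigr => i _.
  have -> : i.+1%:R * (2 ^+ l / 2 ^+ j) * pi = (i.+1 * 2 ^ (l - j))%:R * pi :> R.
    by rewrite natrM natrX -{1}(subnKC (ltnW jl)) exprD [2 ^+ j * _ / _]mulrAC divff ?mul1r//.
  rewrite cos_natpi -[X in _ * X]signr_odd oddM oddX orbF.
  by rewrite subn_eq0 leqNgt jl andbF mulr1.
- rewrite (eq_bigr (fun=> 1)) => [|i _]; first by rewrite sumr_const card_ord mul1n.
  by rewrite divff ?expf_neq0// mulr1 cos_natpi -exprMn mulrNN mulr1 expr1n.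
Qed.

Variable J : nat -> nat.
Hypothesis J_gt0 : forall k, (0 < J k)%N.

(** The geometric weights give uniform convergence for every [J], while a rapidly
    growing [J] makes the weight of the frequency [2 ^ J k] decay arbitrarily slowly
    as a function of that frequency. *)
Definition lacunary_term k t := 2^-1 ^+ k * oscillation (J k) t.
Definition lacunary_primitive := function_series lacunary_term.

Lemma lacunary_term_bound k t : `|lacunary_term k t| <= 2 * 2^-1 ^+ k.
Proof.
have p0 : 0 <= 2^-1 ^+ k :> R by rewrite exprn_ge0// invr_ge0.
by rewrite normrM (ger0_norm p0) mulrC ler_wpM2r// oscillation_bound.
Qed.

Lemma continuous_lacunary_primitive : continuous lacunary_primitive.
Proof.
apply: continuous_function_series => [k t|k]; first exact: lacunary_term_bound.
by apply: continuous_cstM; exact: continuous_oscillation.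
Qed.

Lemma lacunary_primitive_periodic : periodic lacunary_primitive (2 * pi).
Proof.
move=> t; rewrite /lacunary_primitive /function_series.
congr (limn (series _)); apply/funext => k.
by rewrite /lacunary_term oscillation_periodic.
Qed.

Lemma lacunary_primitiveNpi : lacunary_primitive (- pi) = 0.
Proof.
have J0 k : lacunary_term k (- pi) = 0.
  rewrite /lacunary_term /oscillation mulrN cosN -natrX cos_natpi.
  by rewrite -signr_odd oddX; case: (J k) (J_gt0 k) => // l _; rewrite subrr mulr0.
rewrite /lacunary_primitive /function_series.
rewrite (_ : series _ = cst 0) ?lim_cst//.
by apply/funext => n; rewrite /series/= big1.
Qed.

Lemma lacunary_primitivepi : lacunary_primitive pi = 0.
Proof.
rewrite -lacunary_primitiveNpi -[RHS]lacunary_primitive_periodic.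
by congr lacunary_primitive; ring.
Qed.

Lemma lacunary_primitive_Bc : Bc lacunary_primitive.
Proof.
split; [exact: continuous_lacunary_primitive | exact: lacunary_primitiveNpi |].
move=> y n _; rewrite lacunary_primitivepi mulr0 addr0 [2 * _]mulrC -mulrA.
exact: periodic_int lacunary_primitive_periodic.
Qed.

Lemma alternating_sum_lacunary_primitive k : injective J ->
  \sum_(i < (2 ^ J k).*2) (-1) ^+ i.+1 *
      lacunary_primitive (unif_pt (- pi) pi (2 ^ J k).*2 i.+1) =
  2^-1 ^+ k * (2 ^ J k).*2%:R.
Proof.
move=> injJ; set N := (2 ^ J k).*2; set p := unif_pt _ _ _.
have cS : \sum_(i < N) (-1) ^+ i.+1 * series (lacunary_term ^~ (p i.+1)) m
    @[m --> \oo] -->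
    \sum_(i < N) (-1) ^+ i.+1 * lacunary_primitive (p i.+1).
  apply: cvg_big => [|i _]; first exact: add_continuous.
  apply: cvgM; first exact: cvg_cst.
  exact: cvg_function_series lacunary_term_bound _.
(* Only the term of index [k] survives in each partial sum. *)
have cst_S : \sum_(i < N) (-1) ^+ i.+1 * series (lacunary_term ^~ (p i.+1)) m
    @[m --> \oo] -->
    (2^-1 ^+ k * N%:R : R).
  apply: cvg_near_cst; exists k.+1 => // m /= km.
  under eq_bigr do rewrite mulr_sumr.
  rewrite exchange_big/= (bigD1_seq k) ?iota_uniq ?mem_index_iota//=.
  under eq_bigr do rewrite mulrCA.
  rewrite -mulr_sumr alternating_sum_oscillation// eqxx mul1n.
  rewrite big1 ?addr0// => l lk.
  under eq_bigr do rewrite mulrCA.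
  rewrite -mulr_sumr alternating_sum_oscillation// (inj_eq injJ) (negbTE lk).
  by rewrite mul0n mulr0.
exact: cvg_unique cS cst_S.
Qed.

Lemma cp_integral_lacunary (f : schwartz_distribution R) k : injective J ->
  is_distr_derivative f lacunary_primitive ->
  cp_integral f (fun t => @square_wave R ((2 ^ J k)%:R * t)) =
    - (4 * (2^-1 ^+ k * (2 ^ J k)%:R)).
Proof.
move=> injJ fF; rewrite /cp_integral (primitiveE lacunary_primitive_Bc fF).
have pipi : - pi < pi :> R by have := pi_gt0 R; lra.
have n0 : (0 < 2 ^ J k)%N by rewrite expn_gt0.
have := is_stieltjes_integral_square_wave continuous_lacunary_primitive n0.
move=> /(stieltjes_integralE pipi) ->.
rewrite lacunary_primitivepi mul0r sub0r alternating_sum_lacunary_primitive//.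
rewrite -signr_odd oddX orbF eqn0Ngt J_gt0 expr0 mul1r.
by rewrite -muln2 natrM; congr (- _); ring.
Qed.

End LacunarySeries.

Section Sharpness.
Variable R : realType.

(** Along [n = 2 ^ J k] the integral has size [4 * 2^-1 ^+ k * n], so it suffices that
    [psi n <= 2^-1 ^+ k * n] there. *)
Lemma cp_integral_dilation_sharp (psi : nat -> R) : (forall n, 0 < psi n) ->
  psi =o_\oo (fun n : nat => n%:R : R) ->
  exists (f : schwartz_distribution R) (g : R -> R), [/\ Ac f, BVT g &
    ~ ((fun n : nat => cp_integral f (fun t : R => g (n%:R * t))) =o_\oo psi)].
Proof.
move=> psi0 /eqoP psio.
have /choice[N psiN] : forall k, exists Nk, forall n, (Nk <= n)%N ->
    psi n <= 2^-1 ^+ k * n%:R.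
  move=> k.
  have [|Nk _ psiNk] := psio (2^-1 ^+ k); first by rewrite exprn_gt0// invr_gt0.
  exists Nk => n /psiNk /=; rewrite gtr0_norm// ger0_norm//.
(* Increasing, positive, and beyond every threshold: [N k < J k < 2 ^ J k]. *)
pose J k := (\sum_(i < k.+1) (N i).+1)%N.
have JS k : (J k < J k.+1)%N.
  by rewrite /J [X in (_ < X)%N]big_ord_recr/= -addn1 leq_add2l.
have JN k : (N k < J k)%N by rewrite /J big_ord_recr/= leq_addl.
have J0 k : (0 < J k)%N by exact: leq_ltn_trans (JN k).
have kJ k : (k <= J k)%N by elim: k => // k IHk; exact: leq_ltn_trans (JS k).
have injJ : injective J.
  have Jlt : {homo J : i j / (i < j)%N} by apply: homo_ltn => //; exact: ltn_trans.
  move=> i j Jij; have [ij|ji|//] := ltngtP i j.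
    by have := Jlt _ _ ij; rewrite Jij ltnn.
  by have := Jlt _ _ ji; rewrite Jij ltnn.
pose F : R -> R := lacunary_primitive J.
have BF : Bc F by exact: lacunary_primitive_Bc.
have [cF _ _] := BF.
have fF := derivative_distributionP cF.
exists (derivative_distribution cF), (@square_wave R); split.
- by exists F.
- exact: square_wave_BVT.
move=> /eqoP /(_ 1 ltr01) [n0 _ cp_psi].
have := cp_psi (2 ^ J n0)%N.
rewrite /= (leq_trans (kJ n0) (ltnW (ltn_expl _ _)))// => /(_ isT).
rewrite (cp_integral_lacunary J0 n0 injJ fF) normrN mul1r (gtr0_norm (psi0 _)).
have NJ : (N n0 <= 2 ^ J n0)%N.
  by rewrite (leq_trans (ltnW (JN n0)))// ltnW// ltn_expl.
have := psiN _ _ NJ; have := psi0 (2 ^ J n0)%N.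
have := ler_norm (4 * (2^-1 ^+ n0 * (2 ^ J n0)%:R) : R).
lra.
Qed.

End Sharpness.

Theorem proposition17 (R : realType) :
  (forall (f : schwartz_distribution R) (g : R -> R), Ac f -> BVT g ->
    (fun n : nat => cp_integral f (fun t : R => g (n%:R * t)))
      =o_\oo (fun n : nat => n%:R : R)) /\
  (forall psi : nat -> R, (forall n : nat, 0 < psi n) ->
    psi =o_\oo (fun n : nat => n%:R : R) ->
    exists (f : schwartz_distribution R) (g : R -> R), [/\ Ac f, BVT g &
      ~ ((fun n : nat => cp_integral f (fun t : R => g (n%:R * t)))
           =o_\oo psi)]).
Proof.
split=> [f g|psi psi0 psio].
  exact: cp_integral_dilation_littleo.
exact: cp_integral_dilation_sharp.
Qed.
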